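(* Let $c>0$ be a constant and, for each positive integer $n$ with $c/n<1$, let $\mu_{\mathrm{O}}(n,n,c/n)$ denote the matching size obtained by the \textsc{oblivious} algorithm on the random bipartite graph $G(n,n,c/n)$. Then asymptotically almost surely, $$\frac{\mu_{\mathrm{O}}(n,n,c/n)}{n} = 1-e^{(e^{-c}-1)} + o(1),$$ i.e. for every $\varepsilon>0$, $\mathbb{P}\left(\left|\frac{\mu_{\mathrm{O}}(n,n,c/n)}{n} - \left(1-e^{(e^{-c}-1)}\right)\right|>\varepsilon\right)\to 0$ as $n\to\infty$.
   Context: For a positive integer $n$ and $p\in(0,1)$, $G(n,n,p)$ is the random bipartite graph with a set $I$ of $n$ ''bins'' and a set $J$ of $n$ ''balls'', in which each pair $(i,j)\in I\times J$ is an edge independently with probability $p$. Online model: the balls arrive one at a time in a fixed order; when a ball $j$ arrives its set of neighboring bins $N(j)$ is revealed, and the algorithm must immediately and irrevocably either match $j$ to a currently unmatched bin or drop $j$; each bin can be matched to at most one ball. The matching size of an algorithm is the number of matched balls. The \textsc{oblivious} algorithm: when ball $j$ arrives, if $N(j)\neq\emptyset$ it selects a bin $i$ uniformly at random from $N(j)$ (independently of everything else); if $i$ is unmatched, $j$ is matched to $i$, otherwise $j$ is dropped (and $j$ is dropped if $N(j)=\emptyset$). ''Asymptotically almost surely'' means with probability $1-o(1)$ as $n\to\infty$. *)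

(* Defs.v *)
From HB Require Import structures.
From mathcomp Require Import all_boot all_order all_algebra all_fingroup.
From mathcomp Require Import all_classical all_reals all_analysis.

Set Implicit Arguments.
Unset Strict Implicit.
Unset Printing Implicit Defensive.

Import Order.TTheory GRing.Theory Num.Theory.
Import numFieldNormedType.Exports.
Local Open Scope ring_scope.

(* Edges and matched pairs are written (bin, ball). *)
Definition bigraph (n : nat) : finType := {set 'I_n * 'I_n}.

Definition nbhd (n : nat) (G : bigraph n) (j : 'I_n) : {set 'I_n} :=
  [set i | (i, j) \in G].

Definition gnnp_mass (R : realType) (n : nat) (p : R) (G : bigraph n) : R :=
  \prod_(e : 'I_n * 'I_n) (if e \in G then p else 1 - p).

(* [s j] is the bin selected by ball [j], and [None] if it selects nothing. *)
Definition selection (n : nat) : finType := {ffun 'I_n -> option 'I_n}.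

Definition unif_nbr_mass (R : realType) (n : nat) (N : {set 'I_n})
    (o : option 'I_n) : R :=
  match o with
  | Some i => if i \in N then (#|N|%:R)^-1 else 0
  | None => if N == finset.set0 then 1 else 0
  end.

(* Conditional law of the selections given the graph: independent over the
   balls, each one uniform on the neighborhood of its ball. *)
Definition selection_mass (R : realType) (n : nat) (G : bigraph n)
    (s : selection n) : R :=
  \prod_(j < n) unif_nbr_mass R (nbhd G j) (s j).

Definition outcome (n : nat) : finType := (bigraph n * selection n)%type.

Definition outcome_mass (R : realType) (n : nat) (p : R) (w : outcome n) : R :=
  gnnp_mass p w.1 * selection_mass R w.1 w.2.

Definition Pr (R : realType) (n : nat) (p : R) (A : pred (outcome n)) : R :=
  \sum_(w : outcome n | A w) outcome_mass p w.

Definition oblivious_step (n : nat) (s : selection n)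
    (M : {set 'I_n * 'I_n}) (j : 'I_n) : {set 'I_n * 'I_n} :=
  match s j with
  | Some i => if i \in [set e.1 | e in M] then M else (i, j) |: M
  | None => M
  end.

(* The ball arriving at time [k] is [sigma k]. *)
Definition oblivious_matching (n : nat) (sigma : 'S_n) (s : selection n) :
    {set 'I_n * 'I_n} :=
  foldl (oblivious_step s) finset.set0 [seq sigma k | k <- enum 'I_n].

Definition mu_O (n : nat) (sigma : 'S_n) (w : outcome n) : nat :=
  #|[set e.2 | e in oblivious_matching sigma w.2]|.

Lemma outcome_mass_ge0 (R : realType) (n : nat) (p : R) (w : outcome n) :
  0 <= p <= 1 -> 0 <= outcome_mass p w.
Proof.
move=> /andP[p0 p1]; apply: mulr_ge0; apply: prodr_ge0 => i _.
  by case: ifP; rewrite ?subr_ge0.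
by case: (w.2 i) => [k|] /=; case: ifP; rewrite ?invr_ge0 ?ler0n.
Qed.

Lemma sum_unif_nbr_mass (R : realType) (n : nat) (N : {set 'I_n}) :
  \sum_(o : option 'I_n) unif_nbr_mass R N o = 1.
Proof.
rewrite (bigD1 None) //= (@reindex_omap _ _ _ _ _ Some id) /=; last by case.
rewrite (eq_bigl xpredT); last by move=> i; rewrite eqxx.
rewrite -big_mkcond /= sumr_const -[_ *+ _]mulr_natr.
have [->|N0] := eqVneq N finset.set0; first by rewrite cards0 mulr0 addr0.
by rewrite add0r mulVf// pnatr_eq0 cards_eq0.
Qed.

Lemma Pr_setT (R : realType) (n : nat) (p : R) :
  Pr p (fun _ : outcome n => true) = 1.
Proof.
rewrite /Pr /outcome_mass.
rewrite -(pair_bigA _ (fun G s => gnnp_mass p G * selection_mass R G s)) /=.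
under eq_bigr => G _.
  rewrite -big_distrr /= /selection_mass.
  rewrite -(bigA_distr_bigA (fun j o => unif_nbr_mass R (nbhd G j) o)) /=.
  under eq_bigr => j _ do rewrite sum_unif_nbr_mass.
  rewrite big1 // mulr1.
  over.
rewrite /gnnp_mass.
rewrite -bigA_distr /=.
by rewrite big1 // => e _; rewrite addrC subrK.
Qed.

(* Main.v *)
(* The balls matched by the algorithm are as many as the bins selected by some
   ball, so the matching has size n - Z, with Z the number of bins that no ball
   selects.  Averaging over the graph makes the selections independent, each one
   choosing a given bin with probability q = (1 - (1 - p) ^ n) / n by symmetry
   between the bins; hence a set B of bins is left empty with probability
   (1 - #|B| q) ^ n.  With b = (1 - q) ^ n this gives E Z = n b and, since
   1 - 2 q <= (1 - q) ^ 2, also E Z ^ 2 <= n + (n b) ^ 2.  For p = c / n,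
   b tends to exp (exp (- c) - 1), and Chebyshev's inequality concludes. *)
Require Import Defs.
From mathcomp Require Import all_boot all_order all_algebra all_fingroup.
From mathcomp Require Import all_classical all_reals all_analysis.
From mathcomp Require Import ring lra.
Import Order.TTheory GRing.Theory Num.Theory.
Import numFieldNormedType.Exports.
Local Open Scope classical_set_scope.
Local Open Scope ring_scope.

(** * Reduction of the matching size to the number of empty bins *)

Definition empty_bins {n : nat} (s : selection n) : {set 'I_n} :=
  [set i | [forall j, s j != Some i]]%SET.

(** A ball that selects a bin leaves it occupied in either case: it is matched there, or it is
    dropped because the bin was taken already. So occupancy depends only on which bins get
    selected. *)
Lemma foldl_oblivious_step_bins {n : nat} (s : selection n) (l : seq 'I_n)
    (M : {set 'I_n * 'I_n}) :
  [set e.1 | e in foldl (oblivious_step s) M l]%SET =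
  ([set e.1 | e in M] :|: [set i | Some i \in map s l])%SET.
Proof.
elim: l M => [|j l IH] M /=.
  by apply/setP=> i; rewrite !inE orbF.
rewrite IH; apply/setP=> i; rewrite !inE orbA; congr (_ || _).
rewrite /oblivious_step; case: (s j) => [k|]; last by rewrite orbF.
case: ifP => kM.
  by case: (eqVneq i k) => [->|ik]; rewrite ?kM// (inj_eq Some_inj) (negPf ik) orbF.
rewrite finset.imsetU1 !inE (inj_eq Some_inj).
by rewrite orbC.
Qed.

(** A pair is added only when its bin is free, and it records the selection of its ball. The second
    invariant makes the ball determine the bin, so both projections are injective on the
    matching. *)
Lemma foldl_oblivious_step_inv {n : nat} (s : selection n) (l : seq 'I_n)
    (M : {set 'I_n * 'I_n}) :
  {in M &, injective fst} -> {in M, forall e, s e.2 = Some e.1} ->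
  {in foldl (oblivious_step s) M l &, injective fst} /\
  {in foldl (oblivious_step s) M l, forall e, s e.2 = Some e.1}.
Proof.
elim: l M => [|j l IH] M //= injM sM; apply: IH; rewrite /oblivious_step.
  case sj: (s j) => [k|] //; case: ifPn => // kM e e'.
  have kE e1 : e1 \in M -> e1.1 <> k.
    by move=> e1M ek; move: kM; rewrite -ek imset_f.
  rewrite !inE => /predU1P[->|eM] /predU1P[->|e'M] //=.
  - by move/esym/(kE _ e'M).
  - by move/(kE _ eM).
  - exact: injM.
case sj: (s j) => [k|] //; case: ifPn => // kM e.
by rewrite !inE => /predU1P[->|/sM].
Qed.

(** Both projections being injective, matched balls are as many as occupied bins. The arrival order
    disappears because [sigma] runs through all balls. *)
Lemma mu_O_empty_bins {n : nat} (sigma : 'S_n) (w : outcome n) :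
  mu_O sigma w = (n - #|empty_bins w.2|)%N.
Proof.
rewrite /mu_O /oblivious_matching; set l := [seq _ | _ <- _]; set M := foldl _ _ _.
have [inj1 sM] : {in M &, injective fst} /\ {in M, forall e, w.2 e.2 = Some e.1}.
  by apply: foldl_oblivious_step_inv => [e e'|e]; rewrite inE.
have inj2 : {in M &, injective snd}.
  move=> e e' eM e'M ee'; apply: inj1 => //; apply: Some_inj.
  by rewrite -!sM// ee'.
rewrite (card_in_imset inj2) -(card_in_imset inj1) foldl_oblivious_step_bins.
rewrite -[empty_bins _]finset.setCK -[n in (n - _)%N]card_ord -cardsCs.
apply: eq_card => i.
rewrite imset0 finset.set0U !inE negb_forall.
apply/mapP/existsP => [[j _ ->]|[j]]; first by exists j; rewrite negbK.
rewrite negbK => /eqP <-; exists j => //.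
(* Ball [j] arrives at time [sigma^-1 j]. *)
by apply/mapP; exists ((sigma^-1)%g j); rewrite ?mem_enum ?permKV.
Qed.

(** * Law of the selections once the graph is averaged out *)

Definition nbhd_mass {R : realType} {n : nat} (p : R) (N : {set 'I_n}) : R :=
  \prod_i (if i \in N then p else 1 - p).

(** The unconditional law of the selection of a single ball. *)
Definition choice_mass {R : realType} {n : nat} (p : R) (o : option 'I_n) : R :=
  \sum_(N : {set 'I_n}) nbhd_mass p N * unif_nbr_mass R N o.

Lemma sum_option {V : nmodType} {T : finType} (F : option T -> V) :
  \sum_o F o = F None + \sum_i F (Some i).
Proof.
rewrite (bigD1 None) //= (@reindex_omap _ _ _ _ _ Some id) /=; last by case.
by congr (_ + _); apply: eq_bigl => i; rewrite eqxx.
Qed.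

Lemma sum_nbhd_mass {R : realType} (n : nat) (p : R) :
  \sum_(N : {set 'I_n}) nbhd_mass p N = 1.
Proof.
rewrite /nbhd_mass -(bigA_distr _ _ (fun=> p) (fun=> 1 - p)) /=.
by rewrite big1 // => i _; rewrite subrKC.
Qed.

Lemma sum_choice_mass {R : realType} (n : nat) (p : R) :
  \sum_(o : option 'I_n) choice_mass p o = 1.
Proof.
rewrite exchange_big /= -(sum_nbhd_mass n p); apply: eq_bigr => N _.
by rewrite -big_distrr /= sum_unif_nbr_mass mulr1.
Qed.

Lemma choice_mass_None {R : realType} (n : nat) (p : R) :
  choice_mass p (@None 'I_n) = (1 - p) ^+ n.
Proof.
rewrite /choice_mass (bigD1 finset.set0)//= eqxx mulr1 big1 ?addr0.
  rewrite /nbhd_mass; under eq_bigr do rewrite inE.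
  by rewrite prodr_const card_ord.
by move=> N /negPf ->; rewrite mulr0.
Qed.

(** Transposing [i] and [k] permutes the possible neighborhoods and preserves both their mass and
    their cardinality. *)
Lemma choice_mass_sym {R : realType} {n : nat} (p : R) (i k : 'I_n) :
  choice_mass p (Some i) = choice_mass p (Some k).
Proof.
pose t := tperm i k.
rewrite /choice_mass (reindex_inj (imset_inj (@perm_inj _ t))).
apply: eq_bigr => N _; congr (_ * _).
  rewrite /nbhd_mass (reindex_inj (@perm_inj _ t)); apply: eq_bigr => l _.
  by rewrite mem_imset//; exact: perm_inj.
rewrite /= card_imset; last exact: perm_inj.
by rewrite -{1}(tpermR i k) mem_imset//; exact: perm_inj.
Qed.

(** By symmetry the [n] bins share equally the mass that [None] leaves. *)
Lemma choice_mass_Some {R : realType} {n : nat} (p : R) (i : 'I_n) :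
  choice_mass p (Some i) = (1 - (1 - p) ^+ n) / n%:R.
Proof.
have n0 : n%:R != 0 :> R by rewrite pnatr_eq0 -lt0n (leq_ltn_trans _ (ltn_ord i)).
apply: (mulIf n0); rewrite divfK // -choice_mass_None -[in RHS](sum_choice_mass n p).
rewrite sum_option [RHS]addrAC subrr add0r.
rewrite (eq_bigr (fun=> choice_mass p (Some i))).
  by rewrite sumr_const card_ord mulr_natr.
by move=> k _; exact: choice_mass_sym.
Qed.

(** This is the independence of the selections, tested on product functions. It holds because
    distinct balls have disjoint sets of potential edges, so the graph mass and the selection mass
    both factor over balls. *)
Lemma sum_outcome_mass_prod {R : realType} {n : nat} (p : R)
    (F : 'I_n -> option 'I_n -> R) :
  \sum_(w : outcome n) outcome_mass p w * \prod_j F j (w.2 j) =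
  \prod_j \sum_o choice_mass p o * F j o.
Proof.
pose H j N := nbhd_mass p N * \sum_o unif_nbr_mass R N o * F j o.
have -> : \prod_j \sum_o choice_mass p o * F j o =
          \prod_j \sum_(N : {set 'I_n}) H j N.
  apply: eq_bigr => j _; rewrite /choice_mass.
  under eq_bigr do rewrite big_distrl /=.
  rewrite exchange_big /=; apply: eq_bigr => N _.
  by rewrite /H big_distrr /=; apply: eq_bigr => o _; rewrite mulrA.
rewrite bigA_distr_bigA /=.
(* A graph is the same thing as a family of neighborhoods, one per ball. *)
rewrite (@reindex _ _ _ _ _ (fun G : bigraph n => [ffun j => nbhd G j])) /=; last first.
  exists (fun f : {ffun 'I_n -> {set 'I_n}} => [set e | e.1 \in f e.2]%SET) => [G|f] _.
    by apply/setP => -[i j]; rewrite !inE ffunE inE.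
  by apply/ffunP => j; rewrite ffunE; apply/setP => i; rewrite !inE.
rewrite -(pair_bigA _ (fun G s =>
  gnnp_mass p G * selection_mass R G s * \prod_j F j (s j))) /=.
apply: eq_bigr => G _.
under eq_bigr do rewrite -mulrA.
rewrite -big_distrr /=.
under eq_bigr do rewrite /selection_mass -big_split /=.
rewrite -(bigA_distr_bigA (fun j o => unif_nbr_mass R (nbhd G j) o * F j o)) /=.
under [in RHS]eq_bigr do rewrite ffunE.
rewrite big_split /=; congr (_ * _).
rewrite /gnnp_mass (eq_bigr (fun e => if (e.1, e.2) \in G then p else 1 - p)); last first.
  by case.
rewrite -(pair_bigA _ (fun i j => if (i, j) \in G then p else 1 - p)) /=.
rewrite exchange_big /=; apply: eq_bigr => j _; apply: eq_bigr => i _.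
by rewrite inE.
Qed.

(** The indicator of the event is a product over balls: each selection must avoid [B]. *)
Lemma Pr_subset_empty_bins {R : realType} {n : nat} (p : R) (B : {set 'I_n}) :
  Pr p (fun w : outcome n => B \subset empty_bins w.2) =
  (1 - (1 - (1 - p) ^+ n) / n%:R *+ #|B|) ^+ n.
Proof.
pose f (o : option 'I_n) : R := if o is Some i then (i \notin B)%:R else 1.
transitivity (\sum_(w : outcome n) outcome_mass p w * \prod_j f (w.2 j)).
  rewrite /Pr big_mkcond; apply: eq_bigr => w _ /=.
  case: ifPn => [/fintype.subsetP BE|].
    rewrite big1 ?mulr1// => j _; rewrite /f; case sj: (w.2 j) => [i|] //.
    case: (boolP (i \in B)) => // /BE; rewrite inE => /forallP/(_ j).
    by rewrite sj eqxx.
  case/subsetPn => i iB; rewrite inE negb_forall => /existsP[j].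
  by rewrite negbK => /eqP sj; rewrite (bigD1 j)//= /f sj iB mul0r mulr0.
rewrite (sum_outcome_mass_prod p (fun=> f)) prodr_const card_ord; congr (_ ^+ _).
(* Pass to the complement: the mass avoiding [B] plus the mass falling in [B] is the total mass
   1. *)
apply: (canRL (addrK _)).
rewrite -[in RHS](sum_choice_mass n p) !sum_option mulr1.
rewrite -addrA; congr (_ + _).
rewrite (bigID [in B] predT (fun i => choice_mass p (Some i))) /= addrC; congr (_ + _).
  rewrite (eq_bigr (fun=> (1 - (1 - p) ^+ n) / n%:R)) ?sumr_const//.
  by move=> i _; exact: choice_mass_Some.
rewrite [RHS]big_mkcond; apply: eq_bigr => i _.
by case: ifP => _; rewrite ?mulr1 ?mulr0.
Qed.

(** * The exponential limit *)

(* Squeeze: 1 - y <= exp (-y), and 1 - y >= exp (-y / (1 - y)) because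
   1 / (1 - y) = 1 + y / (1 - y). *)
Lemma cvg_exprn_1B {R : realType} (u : R^nat) (l : R) :
  (\forall n \near \oo, 0 <= u n) -> u n @[n --> \oo] --> l ->
  (1 - u n / n%:R) ^+ n @[n --> \oo] --> expR (- l).
Proof.
move=> u0 ul.
have y0 : u n / n%:R @[n --> \oo] --> (0 : R).
  rewrite -[X in _ --> X](mulr0 l); apply: cvgM => //.
  by apply/gtr0_cvgV0; [exact: nbhs_infty_gtr | exact: cvgr_idn].
have yl : u n / (1 - u n / n%:R) @[n --> \oo] --> l.
  rewrite -[X in _ --> X]divr1.
  apply: cvgM => //; apply: cvgV; first exact: oner_neq0.
  by rewrite -[X in _ --> X]subr0; apply: cvgB => //; exact: cvg_cst.
apply: (@squeeze_cvgr _ _ _ _ (fun n => expR (- (u n / (1 - u n / n%:R))))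
   (fun n => expR (- u n))); last first.
- by apply: continuous_cvg; [exact: continuous_expR | exact: cvgN].
- by apply: continuous_cvg; [exact: continuous_expR | exact: cvgN].
near=> n.
have n0 : (0 : R) < n%:R by near: n; exact: nbhs_infty_gtr.
have un0 : 0 <= u n by near: n.
have y1 : u n / n%:R < 1 by near: n; apply: cvgr_lt y0 _ _; exact: ltr01.
set y := u n / n%:R in y1 *.
have yn0 : 0 <= y by rewrite divr_ge0// ltW.
have -> : u n = n%:R * y by rewrite /y mulrC divfK// gt_eqF.
clearbody y.
have y10 : 0 < 1 - y by rewrite subr_gt0.
apply/andP; split; last first.
  rewrite -mulrN expRM_natl; apply: lerXn2r; rewrite ?nnegrE ?expR_ge0 ?(ltW y10)//.
  exact: expR_ge1Dx.
rewrite -mulrA -mulrN expRM_natl; apply: lerXn2r; rewrite ?nnegrE ?expR_ge0 ?(ltW y10)//.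
rewrite expRN -[leRHS]invrK lef_pV2 ?posrE ?invr_gt0 ?expR_gt0//.
apply: le_trans (expR_ge1Dx _).
by rewrite le_eqVlt; apply/orP; left; apply/eqP; field; rewrite gt_eqF.
Unshelve. all: by end_near. Qed.

(** * Moments of the number of empty bins and concentration *)

Lemma sum_outcome_mass_empty_bins {R : realType} (n : nat) (p : R) :
  \sum_(w : outcome n) outcome_mass p w * #|empty_bins w.2|%:R =
  (1 - (1 - (1 - p) ^+ n) / n%:R) ^+ n *+ n.
Proof.
have cardE (w : outcome n) :
    #|empty_bins w.2|%:R = \sum_i ([set i]%SET \subset empty_bins w.2)%:R :> R.
  by rewrite -natr_sum -sum1_card big_mkcond; congr _%:R; apply: eq_bigr => i _;
     rewrite finset.sub1set; case: (i \in _).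
under eq_bigr do rewrite cardE big_distrr /=.
rewrite exchange_big /= -[X in _ = _ *+ X](card_ord n) -sumr_const.
apply: eq_bigr => i _.
have := Pr_subset_empty_bins p [set i]%SET; rewrite cards1 mulr1n => <-.
rewrite /Pr [RHS]big_mkcond; apply: eq_bigr => w _.
by case: ifP => _; rewrite ?mulr1 ?mulr0.
Qed.

(** Expand the square over pairs of bins. Each diagonal pair contributes at most 1, which gives the
    term [n%:R]; off the diagonal, two bins are empty together with probability at most the product
    of their probabilities. *)
Lemma sum_outcome_mass_sqr_empty_bins {R : realType} (n : nat) (p : R) :
  0 <= p <= 1 -> (1 < n)%N ->
  \sum_(w : outcome n) outcome_mass p w * #|empty_bins w.2|%:R ^+ 2 <=
  n%:R + ((1 - (1 - (1 - p) ^+ n) / n%:R) ^+ n * n%:R) ^+ 2.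
Proof.
move=> /andP[p0 p1] n1.
set q := (1 - _) / _.
have n0 : (0 : R) < n%:R by rewrite ltr0n (ltn_trans _ n1).
have q0 : 0 <= q.
  by rewrite divr_ge0 ?ler0n// subr_ge0 exprn_ile1// ?subr_ge0// lerBlDr lerDl.
(* Here [1 < n] is used: [q] is at most 1 / n. This makes the base 1 - 2 q nonnegative, so that
   powers can be compared. *)
have q2 : q *+ 2 <= 1.
  rewrite -mulr_natr mulrAC ler_pdivrMr// mul1r.
  apply: (@le_trans _ _ 2); last by rewrite ler_nat.
  by rewrite ler_piMl// lerBlDr lerDl exprn_ge0// subr_ge0.
have cardE (w : outcome n) : #|empty_bins w.2|%:R ^+ 2 =
    \sum_i \sum_k ([set i; k]%SET \subset empty_bins w.2)%:R :> R.
  rewrite expr2 -sum1_card natr_sum big_mkcond big_distrlr /=.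
  apply: eq_bigr => i _; apply: eq_bigr => k _.
  rewrite finset.subUset !finset.sub1set.
  by case: (i \in _); case: (k \in _); rewrite ?mulr1 ?mulr0.
under eq_bigr do rewrite cardE big_distrr /=.
rewrite exchange_big /=.
have -> : n%:R + ((1 - q) ^+ n * n%:R) ^+ 2 =
    \sum_(i < n) \sum_(k < n) ((i == k)%:R + ((1 - q) ^+ n) ^+ 2).
  have inner (i : 'I_n) : \sum_(k < n) ((i == k)%:R + ((1 - q) ^+ n) ^+ 2) =
      1 + n%:R * ((1 - q) ^+ n) ^+ 2 :> R.
    rewrite big_split /= (bigD1 i)//= eqxx big1 ?addr0.
      by rewrite sumr_const card_ord mulr_natl.
    by move=> k; rewrite eq_sym => /negPf ->.
  under eq_bigr do rewrite inner.
  by rewrite sumr_const card_ord -[RHS]mulr_natl; ring.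
apply: ler_sum => i _; under eq_bigr do rewrite big_distrr /=.
rewrite exchange_big /=; apply: ler_sum => k _.
have -> : \sum_(w : outcome n)
    outcome_mass p w * ([set i; k]%SET \subset empty_bins w.2)%:R =
    (1 - q *+ #|[set i; k]%SET|) ^+ n.
  rewrite -Pr_subset_empty_bins /Pr [RHS]big_mkcond; apply: eq_bigr => w _.
  by case: ifP => _; rewrite ?mulr1 ?mulr0.
rewrite cards2; case: eqVneq => _ /=.
  rewrite mulr1n -[leLHS]addr0 lerD ?sqr_ge0// exprn_ile1//; lra.
rewrite add0r exprAC; apply: lerXn2r; rewrite ?nnegrE ?sqr_ge0//; nra.
Qed.

(** Chebyshev's argument centered at an arbitrary [a] instead of the mean, so the bias of the mean
    enters as a squared term beside the variance bound 1 / n. *)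
Lemma Pr_empty_bins_deviation {R : realType} (n : nat) (p a eps : R) :
  0 <= p <= 1 -> (1 < n)%N -> 0 < eps ->
  Pr p (fun w : outcome n => eps < `|#|empty_bins w.2|%:R / n%:R - a|) <=
  (n%:R^-1 + ((1 - (1 - (1 - p) ^+ n) / n%:R) ^+ n - a) ^+ 2) / eps ^+ 2.
Proof.
move=> p01 n1 eps0.
have n0 : (0 : R) < n%:R by rewrite ltr0n (ltn_trans _ n1).
rewrite ler_pdivlMr ?exprn_gt0// /Pr big_distrl /=.
pose Z (w : outcome n) : R := #|empty_bins w.2|%:R.
apply: (@le_trans _ _ (\sum_(w : outcome n) outcome_mass p w * (Z w / n%:R - a) ^+ 2)).
  rewrite [leLHS]big_mkcond; apply: ler_sum => w _.
  have m0 := @outcome_mass_ge0 R n p w p01.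
  case: ifPn => [epsZ|_]; last by rewrite mulr_ge0// sqr_ge0.
  rewrite ler_wpM2l// -[leRHS]real_normK ?num_real//.
  by apply: lerXn2r; rewrite ?nnegrE ?normr_ge0 ?(ltW eps0) ?(ltW epsZ).
(* Expanding the square leaves the second moment, the first moment and the total mass. *)
have -> : \sum_(w : outcome n) outcome_mass p w * (Z w / n%:R - a) ^+ 2 =
    n%:R^-1 ^+ 2 * (\sum_(w : outcome n) outcome_mass p w * Z w ^+ 2)
    - (2 * a / n%:R) * (\sum_(w : outcome n) outcome_mass p w * Z w)
    + a ^+ 2 * Pr p (fun _ : outcome n => true).
  rewrite /Pr !big_distrr /= -sumrB -big_split /=.
  by apply: eq_bigr => w _; ring.
rewrite Pr_setT sum_outcome_mass_empty_bins.
have := @sum_outcome_mass_sqr_empty_bins R n p p01 n1.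
set b := (1 - (1 - (1 - p) ^+ n) / n%:R) ^+ n.
rewrite -(@ler_pM2l _ (n%:R^-1 ^+ 2)) ?exprn_gt0 ?invr_gt0// => S2.
rewrite -[b *+ n]mulr_natr.
apply: (@le_trans _ _ (n%:R^-1 ^+ 2 * (n%:R + (b * n%:R) ^+ 2) -
  2 * a / n%:R * (b * n%:R) + a ^+ 2 * 1)); first by rewrite !lerD2r.
clearbody b; move: (n%:R : R) n0 => x x0.
by rewrite le_eqVlt; apply/orP; left; apply/eqP; field; rewrite gt_eqF.
Qed.

Theorem theorem1 (R : realType) (c : R) (hc : 0 < c)
    (sigma : forall n : nat, 'S_n) (eps : R) (heps : 0 < eps) :
  (Pr (c / n%:R) (fun w : outcome n =>
     eps < `|(mu_O (sigma n) w)%:R / n%:R - (1 - expR (expR (- c) - 1))|))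
    @[n --> \oo] --> (0 : R).
Proof.
set a := expR (expR (- c) - 1).
pose b n : R := (1 - (1 - (1 - c / n%:R) ^+ n) / n%:R) ^+ n.
have cn1 : \forall n \near \oo, 0 <= c / n%:R <= 1.
  near=> n; have cn : c < n%:R by near: n; exact: nbhs_infty_gtr.
  have n0 : (0 : R) < n%:R := lt_trans hc cn.
  by rewrite divr_ge0 ?ler_pdivrMr ?mul1r ?ltW.
have ba : b n @[n --> \oo] --> a.
  (* The exponential limit is used twice: here with [u n] = 1 - (1 - c / n) ^ n, then with [u]
     constantly [c] to find the limit 1 - exp (- c) of that sequence. *)
  rewrite /a -[_ - 1]opprB; apply: cvg_exprn_1B.
    near=> n; have /andP[c0 c1] : 0 <= c / n%:R <= 1 by near: n.
    by rewrite subr_ge0 exprn_ile1// ?subr_ge0// lerBlDr lerDl.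
  apply: cvgB; first exact: cvg_cst.
  apply: (@cvg_exprn_1B _ (fun=> c)); last exact: cvg_cst.
  by near=> n; exact: ltW.
have bound0 : (n%:R^-1 + (b n - a) ^+ 2) / eps ^+ 2 @[n --> \oo] --> (0 : R).
  rewrite -[X in _ --> X](mul0r (eps ^+ 2)^-1); apply: cvgMl.
  rewrite -[X in _ --> X]addr0; apply: cvgD.
    by apply/gtr0_cvgV0; [exact: nbhs_infty_gtr | exact: cvgr_idn].
  have ba0 : b n - a @[n --> \oo] --> (0 : R).
    by rewrite -[X in _ --> X](subrr a); apply: cvgB => //; exact: cvg_cst.
  by rewrite -[X in _ --> X](mulr0 0); exact: cvgM.
apply: (@squeeze_cvgr _ _ _ _ (fun=> 0)
  (fun n => (n%:R^-1 + (b n - a) ^+ 2) / eps ^+ 2)); [|exact: cvg_cst|exact: bound0].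
near=> n.
have p01 : 0 <= c / n%:R <= 1 by near: n.
have n1 : (1 < n)%N by near: n; exact: nbhs_infty_gt.
have n0 : n%:R != 0 :> R by rewrite pnatr_eq0 -lt0n (ltn_trans _ n1).
rewrite sumr_ge0 /=; last by move=> w _; exact: outcome_mass_ge0.
apply: le_trans (@Pr_empty_bins_deviation R n _ a eps p01 n1 heps).
rewrite le_eqVlt; apply/orP; left; apply/eqP; apply: eq_bigl => w.
(* With Z the number of empty bins, the matching ratio is 1 - Z / n, so its deviation from 1 - [a]
   is the opposite of that of Z / n from [a]. *)
rewrite mu_O_empty_bins natrB; last by rewrite -[leqRHS]card_ord max_card.
by rewrite mulrBl divff//; congr (_ < _); rewrite -[LHS]normrN; congr (`| _ |); ring.
Unshelve. all: by end_near. Qed.
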